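(* Let $n\ge 0$ and let $M^{(n)}=(M_1^{(n)},M_2^{(n)})$ be the numerical solution at time step $n$. Set $K=\|M^{(n)}\|$. If $\Delta t>0$ satisfies $$\Delta t\le \frac{\sqrt{2(\sqrt5-2)}}{5}\,\sqrt{\frac{\Delta x^3\,\Delta y^3}{\Delta x^2+\Delta y^2}}\;\frac1K ,$$ then Scheme 1 (as defined in the context) produces a unique solution at time step $n+1$, i.e. there is exactly one $M^{(n+1)}=(M_1^{(n+1)},M_2^{(n+1)})$ satisfying the equations of Scheme 1 with the given $M^{(n)}$. In the particular case $\Delta x=\Delta y$, the condition reads $$\Delta t\le\frac{\sqrt{\sqrt5-2}}{5}\,\frac{\Delta x^2}{K}.$$
   Context: Fix $\alpha>0$ and integers $\mathcal K,\mathcal J\ge 1$; put $\Delta x=2/\mathcal K$, $\Delta y=2/\mathcal J$. Grid functions are real arrays $f=(f_{k,j})$, $0\le k\le\mathcal K-1$, $0\le j\le\mathcal J-1$, where $k$ is the index in the $x$ direction and $j$ the index in the $y$ direction; they are extended periodically ($k$ modulo $\mathcal K$, $j$ modulo $\mathcal J$). Products of grid functions are entrywise. For a grid function, $\|f\|^2=\sum_{k=0}^{\mathcal K-1}\sum_{j=0}^{\mathcal J-1}f_{k,j}^2\,\Delta x\,\Delta y$, and for a pair $M=(M_1,M_2)$ of grid functions, $\|M\|^2=\|M_1\|^2+\|M_2\|^2$. The discrete operators are $$\delta_k^{<1>}f_{k,j}=\frac{f_{k+1,j}-f_{k-1,j}}{2\Delta x},\quad \delta_j^{<1>}f_{k,j}=\frac{f_{k,j+1}-f_{k,j-1}}{2\Delta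 y},$$ $$\delta_{kk}^{<2>}f_{k,j}=\frac{f_{k+1,j}-2f_{k,j}+f_{k-1,j}}{\Delta x^2},\quad \delta_{jj}^{<2>}f_{k,j}=\frac{f_{k,j+1}-2f_{k,j}+f_{k,j-1}}{\Delta y^2}.$$ At each time level the discrete velocity $U^{(n)}_i$ and momentum $M^{(n)}_i$ ($i=1,2$) are grid functions related by $M^{(n)}_{i}=(1-\alpha^2\delta_{kk}^{<2>}-\alpha^2\delta_{jj}^{<2>})U^{(n)}_{i}$; this operator is invertible, so $U_i^{(n)}$ is determined by $M_i^{(n)}$. Abbreviate $M_i^{(n+\frac12)}=\frac12(M_i^{(n+1)}+M_i^{(n)})$ and $U_i^{(n+\frac12)}=\frac12(U_i^{(n+1)}+U_i^{(n)})$. Scheme 1 is the system, for all $k,j$ (all $U,M$ on the right-hand side are taken at time level $n+\frac12$), $$\frac{M^{(n+1)}_{1;k,j}-M^{(n)}_{1;k,j}}{\Delta t}=-\Big[M_{1;k,j}\,\delta_k^{<1>}U_{1;k,j}+M_{2;k,j}\,\delta_k^{<1>}U_{2;k,j}+\delta_k^{<1>}(M_{1;k,j}U_{1;k,j})+\delta_j^{<1>}(M_{1;k,j}U_{2;k,j})\Big],$$ $$\frac{M^{(n+1)}_{2;k,j}-M^{(n)}_{2;k,j}}{\Delta t}=-\Big[M_{1;k,j}\,\delta_j^{<1>}U_{1;k,j}+M_{2;k,j}\,\delta_j^{<1>}U_{2;k,j}+\delta_k^{<1>}(M_{2;k,j}U_{1;k,j})+\delta_j^{<1>}(M_{2;k,j}U_{2;k,j})\Big].$$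 *)

(* Defs.v *)
From mathcomp Require Import all_boot all_order all_algebra.
From mathcomp Require Import reals.
Set Implicit Arguments.
Unset Strict Implicit.
Unset Printing Implicit Defensive.
Import Order.TTheory GRing.Theory Num.Theory.
Local Open Scope ring_scope.

(* A grid function is a matrix [f : 'M[R]_(K, J)] whose row index is the index
   in the x direction and whose column index is the index in the y direction.
   The periodic extension is carried by [ordS] and [ord_pred], which are
   i + 1 and i - 1 modulo the number of grid points. *)

(* 2 is the side length of the periodic domain in each direction. *)
Definition mesh (R : realType) (N : nat) : R := 2 / N%:R.

Section Grid.
Variables (R : realType) (K J : nat).
Local Notation grid := 'M[R]_(K, J).
Local Notation dx := (mesh R K).
Local Notation dy := (mesh R J).

Definition diffx (f : grid) : grid :=
  \matrix_(k, j) ((f (ordS k) j - f (ord_pred k) j) / (2 * dx)).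
Definition diffy (f : grid) : grid :=
  \matrix_(k, j) ((f k (ordS j) - f k (ord_pred j)) / (2 * dy)).
Definition diffxx (f : grid) : grid :=
  \matrix_(k, j) ((f (ordS k) j - 2 * f k j + f (ord_pred k) j) / dx ^+ 2).
Definition diffyy (f : grid) : grid :=
  \matrix_(k, j) ((f k (ordS j) - 2 * f k j + f k (ord_pred j)) / dy ^+ 2).

Definition gmul (f g : grid) : grid := \matrix_(k, j) (f k j * g k j).

Definition sqnorm (f : grid) : R :=
  \sum_(k < K) \sum_(j < J) f k j ^+ 2 * dx * dy.
Definition pair_norm (M : grid * grid) : R :=
  Num.sqrt (sqnorm M.1 + sqnorm M.2).

Definition helmholtz (alpha : R) (U : grid) : grid :=
  U - alpha ^+ 2 *: diffxx U - alpha ^+ 2 *: diffyy U.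

Definition momentum_of (alpha : R) (U M : grid * grid) : Prop :=
  M.1 = helmholtz alpha U.1 /\ M.2 = helmholtz alpha U.2.

Definition midpoint (A B : grid * grid) : grid * grid := 2^-1 *: (B + A).

Definition scheme1_eqs (dt : R) (M0 M1 U0 U1 : grid * grid) : Prop :=
  let M := midpoint M0 M1 in
  let U := midpoint U0 U1 in
  forall (k : 'I_K) (j : 'I_J),
    (M1.1 k j - M0.1 k j) / dt =
      - (M.1 k j * diffx U.1 k j + M.2 k j * diffx U.2 k j
         + diffx (gmul M.1 U.1) k j + diffy (gmul M.1 U.2) k j) /\
    (M1.2 k j - M0.2 k j) / dt =
      - (M.1 k j * diffy U.1 k j + M.2 k j * diffy U.2 k j
         + diffx (gmul M.2 U.1) k j + diffy (gmul M.2 U.2) k j).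

(* One step of the scheme, from momentum [M0] to momentum [M1]. The velocities
   are determined by the momenta because [helmholtz alpha] is invertible, so
   the existential quantifiers only name them. *)
Definition scheme1 (alpha dt : R) (M0 M1 : grid * grid) : Prop :=
  exists U0 U1 : grid * grid,
    [/\ momentum_of alpha U0 M0, momentum_of alpha U1 M1
      & scheme1_eqs dt M0 M1 U0 U1].

End Grid.

(* Main.v *)
(* Write m for the midpoint momentum, u = u(m) for its velocity, |.| for the
   unweighted l^2 norm and B for the bilinear right-hand side. The scheme says
   m = M - (dt/2) B(m, u), where |B(m, u)| <= 2 Q |m| |u| with
   Q = sqrt (1/dx^2 + 1/dy^2), and the condition on dt gives dt Q |M| <= 1/6.
   Existence: m |-> M - (dt/2) B(m, u(m)) maps the ball of radius 3/2 |M| into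
   itself and halves distances there. Uniqueness holds among all solutions, not
   only in that ball: B(m, u) is orthogonal to u and <m, u> >= |u|^2, so
   |u|^2 <= <m, u> = <M, u> and thus |u| <= |M|; the equation then gives
   |m| <= 6/5 |M|, and two solutions m, m' satisfy
   |m - m'| <= (1/6) (1 + 6/5) |m - m'|. *)

From HB Require Import structures.
Require Import Defs.
From mathcomp Require Import all_boot all_order all_algebra.
From mathcomp Require Import boolp classical_sets reals.
From mathcomp Require Import ring lra.
Set Implicit Arguments.
Unset Strict Implicit.
Unset Printing Implicit Defensive.
Import Order.TTheory GRing.Theory Num.Theory.
Local Open Scope ring_scope.

(** * Real sequences with geometrically small steps *)

Section RealLemmas.
Variable R : realType.

Lemma le0_halving (x c : R) : (forall n, x <= c / 2 ^+ n) -> x <= 0.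
Proof.
move=> xc; rewrite leNgt; apply/negP => x0.
have c0 : 0 <= c by have := xc 0; rewrite expr0 divr1; apply: le_trans; exact: ltW.
(* Archimedean property: some power of 2 exceeds [c / x], against [x * 2 ^+ n <= c]. *)
have := upper_nthrootP (leqnn (Num.bound (c / x))); set n := Num.bound _.
have := xc n; rewrite ler_pdivlMr ?exprn_gt0 // ltr_pdivrMr // => h1 h2.
by have := le_lt_trans h1 h2; rewrite mulrC ltxx.
Qed.

Lemma halving_cvg (a : nat -> R) (d : R) :
  (forall n, `|a n.+1 - a n| <= d / 2 ^+ n.+1) ->
  exists l, forall n, `|a n - l| <= d / 2 ^+ n.
Proof.
move=> ad.
have step n : d / 2 ^+ n = 2 * (d / 2 ^+ n.+1).
  by rewrite exprS invfM; field; rewrite expf_neq0 // pnatr_eq0.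
have adist n p : `|a (n + p)%N - a n| <= d / 2 ^+ n - d / 2 ^+ (n + p).
  elim: p => [|p IH]; first by rewrite addn0 !subrr normr0.
  have := ad (n + p)%N; rewrite -addnS => h.
  have := step (n + p)%N; rewrite -addnS => e.
  by rewrite -(subrKA (a (n + p)%N)) (le_trans (ler_normD _ _))//; lra.
have d0 n : 0 <= d / 2 ^+ n.
  by rewrite step mulr_ge0 // (le_trans _ (ad n)).
have below m n : a m - d / 2 ^+ m <= a n + d / 2 ^+ n.
  case: (leqP m n) => [/subnKC <-|/ltnW /subnKC <-].
    have := adist m (n - m)%N; have := d0 (m + (n - m))%N.
    by rewrite ler_norml => ? /andP[]; lra.
  have := adist n (m - n)%N; have := d0 (n + (m - n))%N.
  by rewrite ler_norml => ? /andP[]; lra.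
pose E := [set y | exists n, y = a n - d / 2 ^+ n]%classic.
(* The intervals [a n - d / 2 ^ n, a n + d / 2 ^ n] are pairwise intersecting. *)
exists (sup E) => n.
have En : E (a n - d / 2 ^+ n) by exists n.
have ubE m : ubound E (a m + d / 2 ^+ m) by move=> _ [p ->].
have := ub_le_sup (ex_intro _ _ (ubE n)) En.
have := ge_sup (ex_intro _ _ En) (ubE n).
by rewrite ler_norml => ? ?; apply/andP; split; lra.
Qed.

End RealLemmas.

(** * The unweighted l^2 norm, completeness and a fixed point theorem *)

Section GridNorm.
Variables (R : realType) (K J : nat).
Local Notation grid := 'M[R]_(K, J).
Implicit Types (f g h : grid) (A B C : grid * grid).

(** The cell area is left out so that every entry is bounded by the norm with constant 1;
    [pair_normE] restores it. *)
Definition ip f g : R := \sum_k \sum_j f k j * g k j.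
Definition ipp A B : R := ip A.1 B.1 + ip A.2 B.2.
Definition nrm A : R := Num.sqrt (ipp A A).

Lemma ipC f g : ip f g = ip g f.
Proof. by apply: eq_bigr => k _; apply: eq_bigr => j _; rewrite mulrC. Qed.

Lemma ipDl f g h : ip (f + g) h = ip f h + ip g h.
Proof.
rewrite -big_split; apply: eq_bigr => k _; rewrite -big_split.
by apply: eq_bigr => j _; rewrite mxE mulrDl.
Qed.

Lemma ipZl (c : R) f g : ip (c *: f) g = c * ip f g.
Proof.
rewrite mulr_sumr; apply: eq_bigr => k _; rewrite mulr_sumr.
by apply: eq_bigr => j _; rewrite mxE mulrA.
Qed.

Lemma ip0l g : ip 0 g = 0.
Proof. by rewrite -(scale0r 0) ipZl mul0r. Qed.

Lemma ipNl f g : ip (- f) g = - ip f g.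
Proof. by rewrite -scaleN1r ipZl mulN1r. Qed.

Lemma ipBl f g h : ip (f - g) h = ip f h - ip g h.
Proof. by rewrite ipDl ipNl. Qed.

Lemma ipDr f g h : ip f (g + h) = ip f g + ip f h.
Proof. by rewrite ipC ipDl !(ipC f). Qed.

Lemma ipBr f g h : ip f (g - h) = ip f g - ip f h.
Proof. by rewrite ipC ipBl !(ipC f). Qed.

Lemma ipZr (c : R) f g : ip f (c *: g) = c * ip f g.
Proof. by rewrite ipC ipZl ipC. Qed.

Lemma ip_ge0 f : 0 <= ip f f.
Proof. by do 2!apply: sumr_ge0 => ? _; rewrite -expr2 sqr_ge0. Qed.

Lemma ippC A B : ipp A B = ipp B A.
Proof. by rewrite /ipp !(ipC A.1) !(ipC A.2). Qed.

Lemma ippDl A B C : ipp (A + B) C = ipp A C + ipp B C.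
Proof. by rewrite /ipp !ipDl addrACA. Qed.

Lemma ippZl (c : R) A B : ipp (c *: A) B = c * ipp A B.
Proof. by rewrite /ipp !ipZl mulrDr. Qed.

Lemma ippNl A B : ipp (- A) B = - ipp A B.
Proof. by rewrite /ipp !ipNl opprD. Qed.

Lemma ipp_ge0 A : 0 <= ipp A A.
Proof. by rewrite addr_ge0 ?ip_ge0. Qed.

Lemma nrm_ge0 A : 0 <= nrm A.
Proof. exact: sqrtr_ge0. Qed.

Lemma nrm_sqr A : nrm A ^+ 2 = ipp A A.
Proof. by rewrite sqr_sqrtr ?ipp_ge0. Qed.

Lemma nrm_le A (c : R) : 0 <= c -> ipp A A <= c ^+ 2 -> nrm A <= c.
Proof. by move=> c0 h; rewrite -(ger0_norm c0) -sqrtr_sqr ler_wsqrtr. Qed.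

Lemma nrmN A : nrm (- A) = nrm A.
Proof. by rewrite /nrm ippNl ippC ippNl opprK. Qed.

Lemma nrmZ (c : R) A : 0 <= c -> nrm (c *: A) = c * nrm A.
Proof.
move=> c0; rewrite /nrm ippZl ippC ippZl mulrA sqrtrM ?mulr_ge0 //.
by rewrite -expr2 sqrtr_sqr ger0_norm.
Qed.

Lemma nrm0 : nrm 0 = 0.
Proof. by rewrite -(scale0r (0 : grid * grid)) nrmZ // mul0r. Qed.

Lemma ipp_le_nrm A B : ipp A B <= nrm A * nrm B.
Proof.
apply: le_trans (ler_norm _) _.
rewrite -sqrtrM ?ipp_ge0 // -sqrtr_sqr ler_wsqrtr //.
have quad (s t : R) :
    0 <= s ^+ 2 * ipp A A + 2 * s * t * ipp A B + t ^+ 2 * ipp B B.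
  have := ipp_ge0 (s *: A + t *: B).
  rewrite !(ippDl, ippZl) !(ippC _ (_ + _)) !(ippDl, ippZl) (ippC B A).
  by congr (_ <= _); ring.
(* [(s, t) := (- <A, B>, <A, A>)] gives the inequality unless <A, A> = 0; then
   a form with <A, B> <> 0 would be negative somewhere on [t = 1]. *)
case: (ltP 0 (ipp A A)) => [A0|A0].
  have := quad (- ipp A B) (ipp A A).
  rewrite (_ : _ + _ = ipp A A * (ipp A A * ipp B B - ipp A B ^+ 2)); last by ring.
  by rewrite pmulr_rge0 // subr_ge0.
have {A0} A0 : ipp A A = 0 by apply/le_anti; rewrite A0 ipp_ge0.
rewrite A0 mul0r leNgt; apply/negP => B0.
have AB0 : ipp A B != 0 by rewrite -sqrf_eq0 gt_eqF.
have := quad (- (ipp B B + 1) / (2 * ipp A B)) 1.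
rewrite A0 (_ : _ + _ = -1); last by field.
by rewrite oppr_ge0 ler10.
Qed.

Lemma nrmD A B : nrm (A + B) <= nrm A + nrm B.
Proof.
apply: nrm_le; first by rewrite addr_ge0 ?nrm_ge0.
rewrite ippDl !(ippC _ (A + B)) !ippDl (ippC B A) sqrrD !nrm_sqr.
by have := ipp_le_nrm A B; lra.
Qed.

Lemma nrmBC A B : nrm (A - B) = nrm (B - A).
Proof. by rewrite -nrmN opprB. Qed.

Lemma ler_sqr_ip f k j : f k j ^+ 2 <= ip f f.
Proof.
rewrite /ip (bigD1 k) //= (bigD1 j) //= -expr2 -addrA ler_wpDr // addr_ge0 //.
  by apply: sumr_ge0 => ? _; rewrite -expr2 sqr_ge0.
by do 2!apply: sumr_ge0 => ? _; rewrite -expr2 sqr_ge0.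
Qed.

Lemma entries_le_nrm A k j : A.1 k j ^+ 2 + A.2 k j ^+ 2 <= nrm A ^+ 2.
Proof. by rewrite nrm_sqr lerD ?ler_sqr_ip. Qed.

Lemma nrm_eq0 A : nrm A <= 0 -> A = 0.
Proof.
move=> A0; have {}A0 : nrm A = 0 by apply/le_anti; rewrite A0 nrm_ge0.
have z k j : A.1 k j = 0 /\ A.2 k j = 0.
  have := entries_le_nrm A k j; rewrite A0 expr0n /= => h.
  have := sqr_ge0 (A.1 k j); have := sqr_ge0 (A.2 k j) => h1 h2.
  by split; apply/eqP; rewrite -sqrf_eq0; apply/eqP; lra.
by rewrite [A]surjective_pairing; congr pair; apply/matrixP => k j; rewrite mxE;
  case: (z k j).
Qed.

Lemma nrm_le_entries A (e : R) : 0 <= e ->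
  (forall k j, `|A.1 k j| <= e) -> (forall k j, `|A.2 k j| <= e) ->
  nrm A <= 2 * (K * J)%:R * e.
Proof.
move=> e0 A1 A2; have c0 : 0 <= (K * J)%:R :> R by [].
apply: nrm_le; first by rewrite !mulr_ge0.
have ipe f : (forall k j, `|f k j| <= e) -> ip f f <= (K * J)%:R * e ^+ 2.
  move=> fe; apply: (@le_trans _ _ (\sum_(k < K) \sum_(j < J) e ^+ 2)).
    apply: ler_sum => k _; apply: ler_sum => j _.
    by rewrite -expr2 -real_normK ?num_real // lerXn2r ?nnegrE.
  by rewrite !sumr_const !card_ord -mulrnA mulr_natl mulnC.
have := ipe _ A1; have := ipe _ A2; rewrite /ipp.
(* For [N = (K * J)%:R], [N <= N ^+ 2] bounds [2 * N * e ^+ 2] by [(2 * N * e) ^+ 2]; the size of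
   the constant is irrelevant later. *)
have cc : (K * J)%:R <= (K * J)%:R ^+ 2 :> R.
  by rewrite -natrX ler_nat; case: (K * J)%N => // n; rewrite leq_pmulr.
have := ler_wpM2r (sqr_ge0 e) cc; rewrite !exprMn.
have : 0 <= (K * J)%:R ^+ 2 * e ^+ 2 by rewrite mulr_ge0 ?sqr_ge0.
lra.
Qed.

(** Entries are dominated by the norm, so [halving_cvg] gives entrywise limits; recombining finitely
    many entries only enlarges the constant. *)
Lemma nrm_complete (x : nat -> grid * grid) (d : R) :
  (forall n, nrm (x n.+1 - x n) <= d / 2 ^+ n.+1) ->
  exists l c, forall n, nrm (x n - l) <= c / 2 ^+ n.
Proof.
move=> xd.
have d0 : 0 <= d.
  by have := le_trans (nrm_ge0 _) (xd 0); rewrite pmulr_lge0 // invr_gt0 exprn_gt0.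
have entry (p : grid * grid -> grid) k j :
    (forall n, p (x n.+1 - x n) k j ^+ 2 <= nrm (x n.+1 - x n) ^+ 2) ->
    (forall n, p (x n.+1 - x n) k j = p (x n.+1) k j - p (x n) k j) ->
    exists l, forall n, `|p (x n) k j - l| <= d / 2 ^+ n.
  move=> ple pB; apply: halving_cvg => n; rewrite -pB.
  apply: le_trans (xd n); rewrite -(ger0_norm (nrm_ge0 _)).
  by rewrite -ler_sqr ?nnegrE // !real_normK ?num_real // ple.
have /choice[l1 l1P] (q : 'I_K * 'I_J) :
    exists l, forall n, `|(x n).1 q.1 q.2 - l| <= d / 2 ^+ n.
  case: q => k j; apply: (entry fst) => n; last by rewrite !mxE.
  by rewrite (le_trans _ (entries_le_nrm _ k j)) // lerDl sqr_ge0.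
have /choice[l2 l2P] (q : 'I_K * 'I_J) :
    exists l, forall n, `|(x n).2 q.1 q.2 - l| <= d / 2 ^+ n.
  case: q => k j; apply: (entry snd) => n; last by rewrite !mxE.
  by rewrite (le_trans _ (entries_le_nrm _ k j)) // lerDr sqr_ge0.
exists (\matrix_(k, j) l1 (k, j), \matrix_(k, j) l2 (k, j)), (2 * (K * J)%:R * d).
move=> n; rewrite -(mulrA _ d); apply: nrm_le_entries => [|k j|k j].
- by rewrite divr_ge0 ?exprn_ge0.
- by rewrite !mxE; exact: (l1P (k, j)).
- by rewrite !mxE; exact: (l2P (k, j)).
Qed.

(** Banach's argument on a closed ball, with the iteration started at 0. *)
Lemma halving_fixpoint (T : grid * grid -> grid * grid) (r : R) : 0 <= r ->
  (forall A, nrm A <= r -> nrm (T A) <= r) ->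
  (forall A B, nrm A <= r -> nrm B <= r -> nrm (T A - T B) <= nrm (A - B) / 2) ->
  exists A, T A = A.
Proof.
move=> r0 Tr Tc.
pose x n := iter n T 0.
have xr n : nrm (x n) <= r.
  elim: n => [|n IH]; last exact: Tr.
  by rewrite /= nrm0.
have [n|l [c xl]] := @nrm_complete x (2 * nrm (x 1%N - x 0%N)).
  elim: n => [|n IH]; first by rewrite expr1 mulrC mulKf ?pnatr_eq0.
  apply: le_trans (Tc (x n.+1) (x n) (xr _) (xr _)) _.
  by rewrite [2 ^+ n.+2]exprSr invfM mulrA ler_pM2r ?invr_gt0.
have lr : nrm l <= r.
  rewrite -subr_le0; apply: (@le0_halving _ _ c) => n.
  have := nrmD (x n) (l - x n); have := xr n; have := xl n.
  by rewrite subrKC nrmBC; lra.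
exists l; apply/eqP; rewrite -subr_eq0; apply/eqP/nrm_eq0.
apply: (@le0_halving _ _ c) => n.
(* [x n.+1] is [T (x n)]; both [T l - T (x n)] and [T (x n) - l] have norm at most
   [c / 2 ^+ n.+1]. *)
have xl1 : nrm (T (x n) - l) <= c / 2 ^+ n.+1 := xl n.+1.
have := nrmD (T l - T (x n)) (T (x n) - l); rewrite subrKA.
have := Tc _ _ lr (xr n); rewrite (nrmBC l).
move: (xl n) xl1; rewrite exprS invfM.
by have := nrm_ge0 (x n - l); lra.
Qed.

End GridNorm.

(** * Difference operators through periodic shifts *)

Section Operators.
Variables (R : realType) (K J : nat).
Local Notation grid := 'M[R]_(K, J).
Local Notation dx := (mesh R K).
Local Notation dy := (mesh R J).
Implicit Types (f g h : grid) (m u A B : grid * grid).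

Definition shx (s : 'I_K -> 'I_K) f : grid := \matrix_(k, j) f (s k) j.
Definition shy (s : 'I_J -> 'I_J) f : grid := \matrix_(k, j) f k (s j).

(** Reindexing along the permutation [t]; periodicity leaves no boundary terms. *)
Lemma ip_shx s t f g : cancel t s -> ip (shx s f) g = ip f (shx t g).
Proof.
move=> ts; have st : injective t := can_inj ts.
rewrite /ip (reindex_inj st); apply: eq_bigr => k _; apply: eq_bigr => j _.
by rewrite !mxE ts.
Qed.

Lemma ip_shy s t f g : cancel t s -> ip (shy s f) g = ip f (shy t g).
Proof.
move=> ts; have st : injective t := can_inj ts.
rewrite /ip; apply: eq_bigr => k _; rewrite (reindex_inj st).
by apply: eq_bigr => j _; rewrite !mxE ts.
Qed.

Lemma ip_shx_shx s f g : bijective s -> ip (shx s f) (shx s g) = ip f g.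
Proof.
case=> t st ts; rewrite (ip_shx _ _ ts); congr ip.
by apply/matrixP => k j; rewrite !mxE ts.
Qed.

Lemma ip_shy_shy s f g : bijective s -> ip (shy s f) (shy s g) = ip f g.
Proof.
case=> t st ts; rewrite (ip_shy _ _ ts); congr ip.
by apply/matrixP => k j; rewrite !mxE ts.
Qed.

Lemma diffxE f :
  diffx f = (2 * dx)^-1 *: (shx (@ordS K) f - shx (@ord_pred K) f).
Proof. by apply/matrixP => k j; rewrite !mxE mulrC. Qed.

Lemma diffyE f :
  diffy f = (2 * dy)^-1 *: (shy (@ordS J) f - shy (@ord_pred J) f).
Proof. by apply/matrixP => k j; rewrite !mxE mulrC. Qed.

(** The shifts by +1 and -1 are mutually adjoint, so their difference is skew. *)
Lemma diffx_skew f g : ip f (diffx g) = - ip (diffx f) g.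
Proof.
rewrite !diffxE ipZl ipZr ipBl ipBr (ip_shx _ _ (@ord_predK K)).
by rewrite (ip_shx _ _ (@ordSK K)) -mulrN opprB.
Qed.

Lemma diffy_skew f g : ip f (diffy g) = - ip (diffy f) g.
Proof.
rewrite !diffyE ipZl ipZr ipBl ipBr (ip_shy _ _ (@ord_predK J)).
by rewrite (ip_shy _ _ (@ordSK J)) -mulrN opprB.
Qed.

(** Parallelogram law: the squared norms of [(g - h) / 2] and [(g + h) / 2] add up to [ip f f]. *)
Lemma ip_half_sub f g h : ip g g = ip f f -> ip h h = ip f f ->
  ip (2^-1 *: (g - h)) (2^-1 *: (g - h)) <= ip f f.
Proof.
move=> gf hf; rewrite ipZl ipZr !(ipBl, ipBr) gf hf (ipC h).
by have := ip_ge0 (g + h); rewrite !(ipDl, ipDr) gf hf (ipC h); lra.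
Qed.

Lemma ip_dx_diffx f : dx != 0 -> ip (dx *: diffx f) (dx *: diffx f) <= ip f f.
Proof.
move=> dx0; rewrite diffxE scalerA invfM mulrCA mulfV // mulr1.
by apply: ip_half_sub; rewrite ip_shx_shx //; [exact: ordS_bij|exact: ord_pred_bij].
Qed.

Lemma ip_dy_diffy f : dy != 0 -> ip (dy *: diffy f) (dy *: diffy f) <= ip f f.
Proof.
move=> dy0; rewrite diffyE scalerA invfM mulrCA mulfV // mulr1.
by apply: ip_half_sub; rewrite ip_shy_shy //; [exact: ordS_bij|exact: ord_pred_bij].
Qed.

(** With [g] and [h] the two shifts of [f], the left side is [- ip (g - f) (g - f)], a discrete
    Dirichlet form. *)
Lemma ip_second_diff_le0 f g h : ip g g = ip f f -> ip h f = ip g f ->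
  ip (g - 2 *: f + h) f <= 0.
Proof.
move=> gf hf; rewrite ipDl ipBl ipZl hf.
by have := ip_ge0 (g - f); rewrite !(ipBl, ipBr) gf (ipC f g); lra.
Qed.

Lemma ip_diffxx_le0 f : ip (diffxx f) f <= 0.
Proof.
have -> : diffxx f =
    (dx ^+ 2)^-1 *: (shx (@ordS K) f - 2 *: f + shx (@ord_pred K) f).
  by apply/matrixP => k j; rewrite !mxE mulrC.
rewrite ipZl mulr_ge0_le0 ?invr_ge0 ?sqr_ge0 // ip_second_diff_le0 //.
  by rewrite ip_shx_shx //; exact: ordS_bij.
by rewrite (ip_shx _ _ (@ordSK K)) ipC.
Qed.

Lemma ip_diffyy_le0 f : ip (diffyy f) f <= 0.
Proof.
have -> : diffyy f =
    (dy ^+ 2)^-1 *: (shy (@ordS J) f - 2 *: f + shy (@ord_pred J) f).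
  by apply/matrixP => k j; rewrite !mxE mulrC.
rewrite ipZl mulr_ge0_le0 ?invr_ge0 ?sqr_ge0 // ip_second_diff_le0 //.
  by rewrite ip_shy_shy //; exact: ordS_bij.
by rewrite (ip_shy _ _ (@ordSK J)) ipC.
Qed.

(** * The Helmholtz operator, its inverse and the velocity *)

Lemma helmholtz_coercive (alpha : R) f : ip f f <= ip (helmholtz alpha f) f.
Proof.
rewrite /helmholtz !ipBl !ipZl.
have h1 := mulr_ge0_le0 (sqr_ge0 alpha) (ip_diffxx_le0 f).
have h2 := mulr_ge0_le0 (sqr_ge0 alpha) (ip_diffyy_le0 f).
lra.
Qed.

Lemma helmholtz_is_linear (alpha : R) : linear (@helmholtz R K J alpha).
Proof. by move=> a f g; apply/matrixP => k j; rewrite !mxE; ring. Qed.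

HB.instance Definition _ (alpha : R) :=
  GRing.isLinear.Build R grid grid _ (@helmholtz R K J alpha)
    (helmholtz_is_linear alpha).

Lemma ip_eq0 f : ip f f <= 0 -> f = 0.
Proof.
move=> f0; apply/matrixP => k j; apply/eqP; rewrite mxE -sqrf_eq0.
by apply/eqP/le_anti; rewrite sqr_ge0 andbT (le_trans (ler_sqr_ip _ _ _)).
Qed.

Definition invhelmholtz (alpha : R) : 'End(grid) :=
  (linfun (@helmholtz R K J alpha))^-1%VF.

(** Coercivity gives injectivity; in finite dimension [invhelmholtz] is then a two-sided inverse. *)
Lemma lker_helmholtz (alpha : R) : lker (linfun (@helmholtz R K J alpha)) == 0%VS.
Proof.
apply/lker0P => f g; rewrite !lfunE /= => fg.
apply/eqP; rewrite -subr_eq0; apply/eqP/ip_eq0.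
by rewrite (le_trans (helmholtz_coercive alpha _)) // linearB /= fg subrr ip0l.
Qed.

Lemma invhelmholtzK (alpha : R) : cancel (invhelmholtz alpha) (helmholtz alpha).
Proof. by move=> f; have := lker0_lfunVK (lker_helmholtz alpha) f; rewrite lfunE. Qed.

Lemma helmholtzK (alpha : R) : cancel (helmholtz alpha) (invhelmholtz alpha).
Proof. by move=> f; have := lker0_lfunK (lker_helmholtz alpha) f; rewrite lfunE. Qed.

Definition velocity (alpha : R) A : grid * grid :=
  (invhelmholtz alpha A.1, invhelmholtz alpha A.2).

Lemma momentum_ofP (alpha : R) U A :
  momentum_of alpha U A <-> U = velocity alpha A.
Proof.
split=> [[A1 A2]|->]; last by split; rewrite invhelmholtzK.
by rewrite /velocity A1 A2 !helmholtzK -surjective_pairing.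
Qed.

Lemma velocityB (alpha : R) A B :
  velocity alpha (A - B) = velocity alpha A - velocity alpha B.
Proof. by rewrite /velocity /= !linearB. Qed.

Lemma velocity_midpoint (alpha : R) A B :
  midpoint (velocity alpha A) (velocity alpha B) = velocity alpha (midpoint A B).
Proof. by rewrite /velocity /midpoint /= !linearZ /= !linearD. Qed.

Lemma velocity_coercive (alpha : R) A :
  nrm (velocity alpha A) ^+ 2 <= ipp A (velocity alpha A).
Proof.
rewrite nrm_sqr /ipp -{1}(invhelmholtzK alpha A.1) -{1}(invhelmholtzK alpha A.2).
by rewrite lerD ?helmholtz_coercive.
Qed.

(** For [u = velocity alpha A]: [|u|^2 <= <A, u> = <B, u> <= |B| |u|]. It serves with [B = A] in
    general and with [B] the given momentum at a solution. *)
Lemma nrm_velocity (alpha : R) A B :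
  ipp A (velocity alpha A) = ipp B (velocity alpha A) ->
  nrm (velocity alpha A) <= nrm B.
Proof.
move=> AB; have := velocity_coercive alpha A; rewrite AB => /le_trans.
move=> /(_ _ (ipp_le_nrm _ _)); have := nrm_ge0 (velocity alpha A).
rewrite le_eqVlt => /predU1P[<- _|u0]; first exact: nrm_ge0.
by rewrite expr2 ler_pM2r.
Qed.

(** * The bilinear right-hand side and its orthogonality to the velocity *)

Definition stretching m u : grid * grid :=
  (gmul m.1 (diffx u.1) + gmul m.2 (diffx u.2),
   gmul m.1 (diffy u.1) + gmul m.2 (diffy u.2)).
Definition transport m u : grid * grid :=
  (diffx (gmul m.1 u.1) + diffy (gmul m.1 u.2),
   diffx (gmul m.2 u.1) + diffy (gmul m.2 u.2)).
Definition flux m u := stretching m u + transport m u.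

Lemma fluxBl m m' u : flux (m - m') u = flux m u - flux m' u.
Proof.
by rewrite /flux /stretching /transport; congr pair; apply/matrixP => k j;
  rewrite !mxE; ring.
Qed.

Lemma fluxBr m u u' : flux m (u - u') = flux m u - flux m u'.
Proof.
by rewrite /flux /stretching /transport; congr pair; apply/matrixP => k j;
  rewrite !mxE; ring.
Qed.

Lemma ip_gmul f g h : ip (gmul f g) h = ip g (gmul f h).
Proof.
by apply: eq_bigr => k _; apply: eq_bigr => j _; rewrite !mxE mulrCA mulrA.
Qed.

(** Summation by parts turns the transport term [d_j (m_i u_j)] tested against [u_i] into minus the
    stretching term [m_i (d_j u_i)] tested against [u_j]; no product rule enters. *)
Lemma flux_orthogonal m u : ipp (flux m u) u = 0.
Proof.
rewrite /ipp /= !ipDl !(ipC (diffx (gmul _ _))) !(ipC (diffy (gmul _ _))).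
by rewrite !diffx_skew !diffy_skew !ip_gmul; ring.
Qed.

(** * Norm bounds for the right-hand side *)

Section Bounds.
Hypotheses (dx0 : dx != 0) (dy0 : dy != 0).

Lemma ip_le (c : R) f g h :
  (forall k j, f k j ^+ 2 <= c * (g k j ^+ 2 + h k j ^+ 2)) ->
  ip f f <= c * (ip g g + ip h h).
Proof.
move=> fgh; rewrite /ip -big_split mulr_sumr; apply: ler_sum => k _.
rewrite -big_split mulr_sumr; apply: ler_sum => j _; exact: fgh.
Qed.

(** A disc centred at 0 is convex and symmetric, so it contains half the difference of two of its
    points. *)
Lemma sqr_half_sub_le (a b a' b' c : R) :
  a ^+ 2 + b ^+ 2 <= c -> a' ^+ 2 + b' ^+ 2 <= c ->
  (2^-1 * (a - a')) ^+ 2 + (2^-1 * (b - b')) ^+ 2 <= c.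
Proof. by have := sqr_ge0 (a + a'); have := sqr_ge0 (b + b'); nra. Qed.

Lemma diffx_le_nrm u k j :
  diffx u.1 k j ^+ 2 + diffx u.2 k j ^+ 2 <= dx ^- 2 * nrm u ^+ 2.
Proof.
have := sqr_half_sub_le (entries_le_nrm u (ordS k) j) (entries_le_nrm u (ord_pred k) j).
rewrite -(ler_pM2l (_ : 0 < dx ^- 2)) ?invr_gt0 ?exprn_even_gt0 //.
by apply: le_trans; rewrite !mxE le_eqVlt; apply/orP; left; apply/eqP; field.
Qed.

Lemma diffy_le_nrm u k j :
  diffy u.1 k j ^+ 2 + diffy u.2 k j ^+ 2 <= dy ^- 2 * nrm u ^+ 2.
Proof.
have := sqr_half_sub_le (entries_le_nrm u k (ordS j)) (entries_le_nrm u k (ord_pred j)).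
rewrite -(ler_pM2l (_ : 0 < dy ^- 2)) ?invr_gt0 ?exprn_even_gt0 //.
by apply: le_trans; rewrite !mxE le_eqVlt; apply/orP; left; apply/eqP; field.
Qed.

(* The constant Q of the header. *)
Definition freq : R := Num.sqrt (dx ^- 2 + dy ^- 2).

Lemma freq_ge0 : 0 <= freq.
Proof. exact: sqrtr_ge0. Qed.

Lemma freq_sqr : freq ^+ 2 = dx ^- 2 + dy ^- 2.
Proof. by rewrite sqr_sqrtr // addr_ge0 // invr_ge0 sqr_ge0. Qed.

Lemma cauchy2 (a b c d e : R) : c ^+ 2 + d ^+ 2 <= e ->
  (a * c + b * d) ^+ 2 <= e * (a ^+ 2 + b ^+ 2).
Proof.
move=> cde; apply: (@le_trans _ _ ((c ^+ 2 + d ^+ 2) * (a ^+ 2 + b ^+ 2))).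
  by have := sqr_ge0 (a * d - b * c); nra.
by rewrite ler_wpM2r // addr_ge0 ?sqr_ge0.
Qed.

(** The differences of [u] are bounded pointwise and [m] in l^2; the two components contribute
    [dx ^- 2] and [dy ^- 2] to [freq ^+ 2]. *)
Lemma nrm_stretching m u : nrm (stretching m u) <= freq * nrm m * nrm u.
Proof.
apply: nrm_le; first by rewrite !mulr_ge0 ?freq_ge0 ?nrm_ge0.
rewrite !exprMn freq_sqr (nrm_sqr m) mulrAC mulrDl mulrDl.
apply: lerD; apply: ip_le => k j; rewrite !mxE; apply: cauchy2.
  by have := diffx_le_nrm u k j; rewrite !mxE.
by have := diffy_le_nrm u k j; rewrite !mxE.
Qed.

(** Cauchy-Schwarz against the vector [(1/dx, 1/dy)] of length [freq] leaves scaled differences,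
    which do not increase the l^2 norm. *)
Lemma ip_div_le f g :
  ip (diffx f + diffy g) (diffx f + diffy g) <= freq ^+ 2 * (ip f f + ip g g).
Proof.
apply: (@le_trans _ _ (freq ^+ 2 *
    (ip (dx *: diffx f) (dx *: diffx f) + ip (dy *: diffy g) (dy *: diffy g)))).
  apply: ip_le => k j.
  have -> : (diffx f + diffy g) k j =
      (dx *: diffx f) k j * dx^-1 + (dy *: diffy g) k j * dy^-1.
    by rewrite !mxE; field; rewrite dx0 dy0.
  by apply: cauchy2; rewrite freq_sqr !exprVn.
by rewrite ler_wpM2l ?sqr_ge0 // lerD ?ip_dx_diffx ?ip_dy_diffy.
Qed.

Lemma ip_gmul_le f u :
  ip (gmul f u.1) (gmul f u.1) + ip (gmul f u.2) (gmul f u.2) <= ip f f * nrm u ^+ 2.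
Proof.
rewrite /ip -big_split mulr_suml; apply: ler_sum => k _.
rewrite -big_split mulr_suml; apply: ler_sum => j _; rewrite !mxE /=.
have := ler_wpM2l (sqr_ge0 (f k j)) (entries_le_nrm u k j).
by rewrite -!expr2 !exprMn mulrDr.
Qed.

Lemma nrm_transport m u : nrm (transport m u) <= freq * nrm m * nrm u.
Proof.
apply: nrm_le; first by rewrite !mulr_ge0 ?freq_ge0 ?nrm_ge0.
rewrite !exprMn (nrm_sqr m) -mulrA mulrDl mulrDr.
by apply: lerD; apply: le_trans (ip_div_le _ _) _;
  rewrite ler_wpM2l ?sqr_ge0 // ip_gmul_le.
Qed.

Lemma nrm_flux m u : nrm (flux m u) <= 2 * freq * nrm m * nrm u.
Proof.
have := nrm_stretching m u; have := nrm_transport m u.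
by have := nrmD (stretching m u) (transport m u); rewrite /flux; lra.
Qed.

End Bounds.
End Operators.

(** * The scheme as a fixed point problem for the midpoint *)

Section Midpoint.
Variables (R : realType) (K J : nat) (alpha dt : R).
Local Notation grid := 'M[R]_(K, J).
Local Notation vel := (velocity alpha).
Hypotheses (dx0 : mesh R K != 0) (dy0 : mesh R J != 0) (hdt : 0 < dt).
Implicit Types (m A B M : grid * grid).

Definition midpoint_map M m := M - (dt / 2) *: flux m (vel m).

(** Since [M' - M = 2 (m - M)] for the midpoint [m], the scheme is an equation for [m] alone once
    the velocities are eliminated. *)
Lemma scheme1P M M' :
  scheme1 alpha dt M M' <-> midpoint_map M (midpoint M M') = midpoint M M'.
Proof.
have dt0 : dt != 0 by rewrite gt_eqF.
set m := midpoint M M'.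
have entry (x y z : R) : (y - x) / dt = - z <-> x - dt / 2 * z = 2^-1 * (y + x).
  split=> [e|e]; last by have -> : y = x - dt * z; [lra|field].
  have -> : y = x + dt * ((y - x) / dt) by field.
  by rewrite e; field.
have fE k j : (flux m (vel m)).1 k j = m.1 k j * diffx (vel m).1 k j
      + m.2 k j * diffx (vel m).2 k j
      + diffx (gmul m.1 (vel m).1) k j + diffy (gmul m.1 (vel m).2) k j /\
   (flux m (vel m)).2 k j = m.1 k j * diffy (vel m).1 k j
      + m.2 k j * diffy (vel m).2 k j
      + diffx (gmul m.2 (vel m).1) k j + diffy (gmul m.2 (vel m).2) k j.
  by split; rewrite !mxE !addrA.
transitivity (forall k j,
    (M'.1 k j - M.1 k j) / dt = - (flux m (vel m)).1 k j /\
    (M'.2 k j - M.2 k j) / dt = - (flux m (vel m)).2 k j).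
  split=> [[U0 [U1 []]]|h].
    move=> /momentum_ofP -> /momentum_ofP -> e k j.
    by have [-> ->] := fE k j; have := e k j; rewrite velocity_midpoint.
  exists (vel M), (vel M'); split; [exact/momentum_ofP|exact/momentum_ofP|].
  move=> k j; rewrite velocity_midpoint.
  by have := h k j; have [-> ->] := fE k j.
split=> [h|h k j].
  rewrite [LHS]surjective_pairing [RHS]surjective_pairing.
  congr pair; apply/matrixP => k j; have [h1 h2] := h k j.
    by move/entry: h1; rewrite !mxE.
  by move/entry: h2; rewrite !mxE.
have h1 : (midpoint_map M m).1 k j = m.1 k j by rewrite h.
have h2 : (midpoint_map M m).2 k j = m.2 k j by rewrite h.
by split; apply/entry; [move: h1|move: h2]; rewrite !mxE.
Qed.

Local Notation lam := (dt * freq R K J).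

Lemma nrm_dt_flux m u : nrm ((dt / 2) *: flux m u) <= lam * nrm m * nrm u.
Proof.
rewrite nrmZ; last by rewrite divr_ge0 ?ltW.
have := ler_wpM2l (ltW hdt) (nrm_flux dx0 dy0 m u); lra.
Qed.

(** Bilinearity: [flux A (vel A) - flux B (vel B)] is [flux (A - B) (vel A) + flux B (vel (A -
    B))]. *)
Lemma midpoint_map_sub M A B : nrm (midpoint_map M A - midpoint_map M B) <=
  lam * nrm (A - B) * nrm (vel A) + lam * nrm B * nrm (vel (A - B)).
Proof.
have -> : midpoint_map M A - midpoint_map M B =
    - ((dt / 2) *: flux (A - B) (vel A) + (dt / 2) *: flux B (vel (A - B))).
  rewrite velocityB fluxBl fluxBr -scalerDr subrKA scalerBr opprB /midpoint_map.
  by rewrite opprB addrC addrA subrK.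
by rewrite nrmN (le_trans (nrmD _ _)) // lerD // nrm_dt_flux.
Qed.

Lemma midpoint_map_velocity M m : midpoint_map M m = m -> nrm (vel m) <= nrm M.
Proof.
move=> e; apply: nrm_velocity; rewrite -{1}e /midpoint_map ippDl ippNl ippZl.
by rewrite flux_orthogonal mulr0 subr0.
Qed.

Lemma lam_ge0 : 0 <= lam.
Proof. by rewrite mulr_ge0 ?freq_ge0 // ltW. Qed.

Lemma nrm_velocity_le m : nrm (vel m) <= nrm m.
Proof. exact: nrm_velocity. Qed.

Lemma midpoint_map_fixpoint M : lam * nrm M <= 6^-1 ->
  exists m, midpoint_map M m = m.
Proof.
move=> small; have n0 := @nrm_ge0 R K J.
have l0 := lam_ge0.
have prodn (p q : R) A B : nrm A <= p -> nrm B <= q ->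
    lam * nrm A * nrm B <= lam * p * q.
  by move=> Ap Bq; apply: ler_pM => //; [exact: mulr_ge0|exact: ler_wpM2l].
(* With [lam |M| <= 1/6], images have norm at most [(1 + 9/4 * 1/6) |M| = 11/8 |M|], and the
   Lipschitz factor is at most [(3/2 + 3/2) * 1/6 = 1/2]. *)
apply: (@halving_fixpoint _ _ _ _ (3 / 2 * nrm M)) => [|A Ar|A B Ar Br].
- by rewrite mulr_ge0 ?divr_ge0.
- have Vr := le_trans (nrm_velocity_le A) Ar.
  apply: le_trans (nrmD _ _) _; rewrite nrmN.
  have := nrm_dt_flux A (vel A).
  have := prodn _ _ _ _ Ar Vr.
  by have := ler_wpM2r (n0 M) small; have := n0 M; lra.
- apply: le_trans (midpoint_map_sub _ _ _) _.
  have Vr := le_trans (nrm_velocity_le A) Ar.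
  have := prodn _ _ (A - B) (vel A) (lexx _) Vr.
  have := prodn _ _ B (vel (A - B)) Br (nrm_velocity_le _).
  by have := ler_wpM2r (n0 (A - B)) small; lra.
Qed.

Lemma midpoint_map_fixpoint_uniq M A B : lam * nrm M <= 6^-1 ->
  midpoint_map M A = A -> midpoint_map M B = B -> A = B.
Proof.
move=> small TA TB; have n0 := @nrm_ge0 R K J.
have l0 := lam_ge0.
have VA := midpoint_map_velocity TA.
have VB := midpoint_map_velocity TB.
(* From [|B| <= |M| + lam |B| |M| <= |M| + |B| / 6]. *)
have nB : nrm B <= 6 / 5 * nrm M.
  have : nrm B <= nrm M + lam * nrm B * nrm (vel B).
    rewrite -{1}TB; apply: le_trans (nrmD _ _) _.
    by rewrite nrmN lerD2l nrm_dt_flux.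
  have := ler_wpM2l (mulr_ge0 l0 (n0 B)) VB.
  by have := ler_wpM2r (n0 B) small; lra.
apply/eqP; rewrite -subr_eq0; apply/eqP/nrm_eq0.
(* The total factor [1/6 + 6/5 * 1/6 = 11/30] is below 1. *)
have := midpoint_map_sub M A B; rewrite TA TB.
have := ler_wpM2l (mulr_ge0 l0 (n0 (A - B))) VA.
have := ler_wpM2l (mulr_ge0 l0 (n0 B)) (nrm_velocity_le (A - B)).
have := ler_wpM2r (n0 (A - B)) (ler_wpM2l l0 nB).
have := ler_wpM2r (n0 (A - B)) small.
by have := n0 (A - B); lra.
Qed.

Lemma scheme1_exists_unique M : lam * nrm M <= 6^-1 ->
  exists! M', scheme1 alpha dt M M'.
Proof.
move=> small; have [m mP] := midpoint_map_fixpoint small.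
have midK B : midpoint M (2 *: B - M) = B.
  by rewrite /midpoint subrK scalerK ?pnatr_eq0.
have midKr B : 2 *: midpoint M B - M = B.
  by rewrite /midpoint scalerKV ?pnatr_eq0 // addrK.
exists (2 *: m - M); split=> [|M' /scheme1P M'P].
  by apply/scheme1P; rewrite midK.
by rewrite (midpoint_map_fixpoint_uniq small mP M'P) midKr.
Qed.

End Midpoint.

(** * The condition on the time step *)

Lemma pair_normE (R : realType) (K J : nat) (M : 'M[R]_(K, J) * 'M[R]_(K, J)) :
  pair_norm M = Num.sqrt (mesh R K * mesh R J) * nrm M.
Proof.
have m0 N : 0 <= mesh R N by rewrite divr_ge0.
have sqnormE (f : 'M[R]_(K, J)) : sqnorm f = mesh R K * mesh R J * ip f f.
  rewrite /sqnorm mulr_sumr; apply: eq_bigr => k _; rewrite mulr_sumr.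
  by apply: eq_bigr => j _; ring.
by rewrite /pair_norm !sqnormE -mulrDr sqrtrM // (mulr_ge0 (m0 K) (m0 J)).
Qed.

(** As [freq ^+ 2 = (dx^2 + dy^2) / (dx^2 dy^2)], the mesh factor of the condition leaves exactly
    the weight relating [pair_norm] to [nrm]. *)
Lemma sqrt_cfl (R : realType) (K J : nat) :
  0 < mesh R K -> 0 < mesh R J ->
  let dx := mesh R K in let dy := mesh R J in
  freq R K J * Num.sqrt ((dx ^+ 3 * dy ^+ 3) / (dx ^+ 2 + dy ^+ 2))
  = Num.sqrt (dx * dy).
Proof.
move=> dx0 dy0 /=; have s0 : 0 < mesh R K ^+ 2 + mesh R J ^+ 2.
  by rewrite addr_gt0 ?exprn_gt0.
rewrite /freq -sqrtrM ?addr_ge0 ?invr_ge0 ?exprn_ge0 ?ltW //; congr Num.sqrt.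
by field; rewrite !gt_eqF.
Qed.

Lemma sqrt5_bound (R : realType) : Num.sqrt (2 * (Num.sqrt 5 - 2)) / 5 <= 6^-1 :> R.
Proof.
(* [(9/4)^2 = 81/16 >= 5], and then [2 * (9/4 - 2) = 1/2 <= (5/6)^2]. *)
have s5 : Num.sqrt 5 <= 9 / 4 :> R.
  by rewrite -[leRHS]ger0_norm ?divr_ge0 // -sqrtr_sqr ler_wsqrtr //; lra.
suff : Num.sqrt (2 * (Num.sqrt 5 - 2)) <= 5 / 6 :> R by lra.
rewrite -[leRHS]ger0_norm ?divr_ge0 // -sqrtr_sqr ler_wsqrtr //; lra.
Qed.

(* For M = 0 the bound is +oo, i.e. there is no restriction on dt. *)
Theorem theorem2 (R : realType) (alpha : R) (halpha : 0 < alpha)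
    (K J : nat) (hK : (1 <= K)%N) (hJ : (1 <= J)%N)
    (M : 'M[R]_(K, J) * 'M[R]_(K, J)) (dt : R) (hdt : 0 < dt) :
  let dx := mesh R K in
  let dy := mesh R J in
  let normM := pair_norm M in
  ((normM != 0 ->
    dt <= Num.sqrt (2 * (Num.sqrt 5 - 2)) / 5
          * Num.sqrt ((dx ^+ 3 * dy ^+ 3) / (dx ^+ 2 + dy ^+ 2))
          * (1 / normM)) ->
   exists! M' : 'M[R]_(K, J) * 'M[R]_(K, J), scheme1 alpha dt M M')
  /\
  (dx = dy ->
   (dt <= Num.sqrt (2 * (Num.sqrt 5 - 2)) / 5
          * Num.sqrt ((dx ^+ 3 * dy ^+ 3) / (dx ^+ 2 + dy ^+ 2))
          * (1 / normM)
    <-> dt <= Num.sqrt (Num.sqrt 5 - 2) / 5 * (dx ^+ 2 / normM))).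
Proof.
move=> dx dy normM.
have dx0 : 0 < dx by rewrite divr_gt0 ?ltr0n.
have dy0 : 0 < dy by rewrite divr_gt0 ?ltr0n.
split=> [cfl|dxy].
  apply: scheme1_exists_unique; rewrite ?gt_eqF //.
  have [M0|M0] := eqVneq (nrm M) 0; first by rewrite M0 mulr0 invr_ge0.
  have s0 : 0 < Num.sqrt (dx * dy) by rewrite sqrtr_gt0 mulr_gt0.
  have nM : normM = Num.sqrt (dx * dy) * nrm M := pair_normE M.
  have n0 : 0 < normM by rewrite nM mulr_gt0 // lt_def M0 nrm_ge0.
  have := cfl (lt0r_neq0 n0).
  rewrite mul1r ler_pdivlMr // nM => h.
  have f0 := freq_ge0 R K J.
  have := ler_wpM2r f0 h.
  rewrite -[leRHS]mulrA [_ * freq _ _ _ in leRHS]mulrC sqrt_cfl // => {}h.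
  apply: le_trans (sqrt5_bound R); rewrite -(ler_pM2r s0).
  by apply: le_trans h; rewrite le_eqVlt; apply/orP; left; apply/eqP; ring.
(* The two bounds are equal reals, also for [normM = 0], where both are 0 by the convention on
   division. *)
have -> : Num.sqrt (2 * (Num.sqrt 5 - 2)) / 5
          * Num.sqrt ((dx ^+ 3 * dy ^+ 3) / (dx ^+ 2 + dy ^+ 2)) * (1 / normM)
   = Num.sqrt (Num.sqrt 5 - 2) / 5 * (dx ^+ 2 / normM); last by [].
rewrite -dxy mul1r [RHS]mulrA; congr (_ / _).
have s5 : 0 <= Num.sqrt 5 - 2 :> R.
  by rewrite subr_ge0 -[2]ger0_norm // -sqrtr_sqr ler_wsqrtr //; lra.
rewrite mulrAC [RHS]mulrAC; congr (_ / _).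
(* Under the merged root, [2 * dx^6 / (2 * dx^2) = dx^4] is the square of [dx ^+ 2]. *)
rewrite -sqrtrM ?mulr_ge0 // -[dx ^+ 2 in RHS]ger0_norm ?sqr_ge0 //.
rewrite -sqrtr_sqr -sqrtrM //; congr Num.sqrt.
by field; rewrite gt_eqF // addr_gt0 ?exprn_gt0.
Qed.
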